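(* Let $G=(V,E)$ be a graph with vertex set $V=\{1,\ldots,v\}$, $v\geq 2$, and edge set $E=\{\epsilon_1,\ldots,\epsilon_e\}\subseteq\{(i,j):1\leq i<j\leq v\}$ with $e\geq 1$. Let $A_1,\ldots,A_k\subseteq V$ with $\bigcup_{i\leq k}A_i=V$. Then as $x\to\infty$, $$\sum_{\substack{a_1,\ldots,a_v\leq x\\ G\text{-wise coprime}\\ \forall i\leq k:\ \prod_{j\in A_i}a_j\leq x}}\frac{1}{a_1\cdots a_v}=\rho(G)\,\mathrm{vol}(D)\,\log^v x+O(\log^{v-1}x),$$ where $D=\{(t_1,\ldots,t_v)\in[0,\infty)^v:\ \sum_{j\in A_i}t_j\leq 1\ \text{for all } i\leq k\}$.
   Context: A tuple $(a_1,\ldots,a_v)$ of positive integers is $G$-wise coprime if $\gcd(a_i,a_j)=1$ whenever $(i,j)\in E$. For positive integers $m_1,\ldots,m_e$ and each vertex $r$, let $M_r$ be the least common multiple of those $m_i$ for which the edge $\epsilon_i$ contains the vertex $r$ ($M_r=1$ if there are none). Then $\rho(G)=\sum_{m_1,\ldots,m_e=1}^{\infty}\frac{\mu(m_1)\cdots\mu(m_e)}{M_1\cdots M_v}$ (an absolutely convergent series), where $\mu$ is the Möbius function. $\mathrm{vol}$ denotes $v$-dimensional Lebesgue measure. *)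

(* Defs.v *)
From HB Require Import structures.
From mathcomp Require Import all_boot all_order all_algebra.
From mathcomp Require Import all_classical all_reals all_analysis.

Set Implicit Arguments.
Unset Strict Implicit.
Unset Printing Implicit Defensive.

Import Order.TTheory GRing.Theory Num.Theory.
Import numFieldNormedType.Exports.

Local Open Scope classical_set_scope.
Local Open Scope ring_scope.

Section TupleLebesgue.
Context (R : realType).
Local Notation mR := (measurableTypeR R).

Definition consp n (p : mR * n.-tuple mR) : n.+1.-tuple mR :=
  [the n.+1.-tuple mR of p.1 :: p.2].

Lemma measurable_consp n : measurable_fun [set: mR * n.-tuple mR] (@consp n).
Proof. exact: measurable_cons. Qed.

Section Step.
Variables (n : nat) (m : {sigma_finite_measure set (n.-tuple mR) -> \bar R}).

Definition leb_step : set (n.+1.-tuple mR) -> \bar R :=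
  pushforward (@lebesgue_measure R \x m)%E (@consp n).

Let leb_step0 : leb_step set0 = 0%E.
Proof. by rewrite /leb_step /pushforward preimage_set0 measure0. Qed.

Let leb_step_ge0 A : (0 <= leb_step A)%E.
Proof. by rewrite /leb_step /pushforward; exact: measure_ge0. Qed.

Let leb_step_sigma_additive : semi_sigma_additive leb_step.
Proof.
have mP (B : set (n.+1.-tuple mR)) : measurable B -> measurable (@consp n @^-1` B).
  by move=> mB; rewrite -[X in measurable X]setTI; exact: measurable_consp.
move=> F mF tF mUF; rewrite /leb_step /pushforward preimage_bigcup.
apply: measure_semi_sigma_additive.
- by move=> i; exact: mP.
- apply/trivIsetP => /= i j _ _ ij; rewrite -preimage_setI.
  by move/trivIsetP : tF => /(_ _ _ _ _ ij) ->//; rewrite preimage_set0.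
- by rewrite -preimage_bigcup; exact: mP.
Qed.

HB.instance Definition _ := isMeasure.Build _ _ _ leb_step
  leb_step0 leb_step_ge0 leb_step_sigma_additive.

Let leb_step_sigma_finite : sigma_finite setT leb_step.
Proof.
have /sigma_finiteP[F [TF ndF Foo]] := sigma_finiteT (@lebesgue_measure R).
have /sigma_finiteP[G [TG ndG Goo]] := sigma_finiteT m.
pose unc (t : n.+1.-tuple mR) : mR * n.-tuple mR := (thead t, [tuple of behead t]).
have munc : measurable_fun setT unc.
  apply: measurable_fun_pair; first exact: measurable_tnth.
  exact: measurable_behead.
have conspK : cancel (@consp n) unc.
  by move=> [x t]; congr (_, _); apply: val_inj.
exists (fun i => unc @^-1` (F i `*` G i)).
  rewrite -preimage_bigcup -(@preimage_setT _ _ unc); congr (_ @^-1` _).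
  rewrite -setXTT TF TG predeqE => -[x y]; split.
    move=> [/= [i _ Fix] [j _ Gjy]]; exists (maxn i j) => //; split.
    - by move: x Fix; exact/subsetPset/ndF/leq_maxl.
    - by move: y Gjy; exact/subsetPset/ndG/leq_maxr.
  by move=> [i _ []/= ? ?]; split; exists i.
move=> i; have [? ?] := Foo i; have [? ?] := Goo i; split.
  by rewrite -[X in measurable X]setTI; apply: munc => //; exact: measurableX.
rewrite /leb_step /pushforward -comp_preimage.
rewrite (_ : unc \o _ = id); last by apply/funext => p /=; rewrite conspK.
by rewrite preimage_id product_measure1E// lte_mul_pinfty// ge0_fin_numE.
Qed.

HB.instance Definition _ := Measure_isSigmaFinite.Build _ _ _ leb_step
  leb_step_sigma_finite.

End Step.

(* n-dimensional Lebesgue measure on the Borel sets of R^n, built by iterating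
   the product with the one-dimensional one; [lebesgue_tuple_box] gives its
   value on boxes. *)
Fixpoint lebesgue_tuple n : {sigma_finite_measure set (n.-tuple mR) -> \bar R} :=
  if n is n'.+1 then leb_step (lebesgue_tuple n')
  else \d_([tuple] : 0.-tuple mR).

Lemma lebesgue_tuple_box n (B : 'I_n -> set mR) : (forall i, measurable (B i)) ->
  lebesgue_tuple n [set t | forall i, B i (tnth t i)] =
  (\prod_(i < n) lebesgue_measure (B i))%E.
Proof.
elim: n B => [|n IHn] B mB.
  by rewrite big_ord0 /= diracE mem_set// => -[].
rewrite big_ord_recl -IHn// /= /leb_step /pushforward.
rewrite (_ : _ @^-1` _ = B ord0 `*`
    [set t | forall i, B (lift ord0 i) (tnth t i)]); last first.
  apply/seteqP; split=> [[x t] /= Bxt|[x t] /= [Bx Bt] i].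
    by split=> [|i]; [have := Bxt ord0|have := Bxt (lift ord0 i); rewrite tnthS].
  by case: (unliftP ord0 i) => [j|] ->; rewrite ?tnthS.
rewrite product_measure1E//.
rewrite (_ : [set t | _] =
    \bigcap_(i in [set: 'I_n]) ((@tnth n mR)^~ i @^-1` B (lift ord0 i))); last first.
  by apply/seteqP; split=> [t Bt i _|t Bt i]; [exact: Bt|exact: (Bt i)].
apply: fin_bigcap_measurable => // i _.
by rewrite -[X in measurable X]setTI; exact: measurable_tnth.
Qed.

End TupleLebesgue.

Definition mobius (n : nat) : int :=
  if (0 < n)%N && all (fun p => logn p n == 1%N) (primes n)
  then (-1) ^+ size (primes n) else 0.

Section Graph.
Context (R : realType) (v : nat).
Variable E : {set 'I_v * 'I_v}.

(* The edges eps_1, ..., eps_e are enumerated by [enum_val : 'I_#|E| -> _]. *)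
Definition edge_lcm (m : {ffun 'I_#|E| -> nat}) (r : 'I_v) : nat :=
  \big[lcmn/1%N]_(i < #|E| |
     (r == (enum_val i).1) || (r == (enum_val i).2)) m i.

Definition rho_term (m : {ffun 'I_#|E| -> nat}) : R :=
  (\prod_(i < #|E|) mobius (m i))%:~R / (\prod_(r < v) edge_lcm m r)%N%:R.

(* [esum] is only meaningful for nonnegative families, so the absolutely
   convergent sum is the difference of the sums of the positive and negative
   parts. *)
Definition rho : R :=
  let P := [set m : {ffun 'I_#|E| -> nat} | forall i, (0 < m i)%N] in
  fine (\esum_(m in P) (EFin \o rho_term)^\+ m
        - \esum_(m in P) (EFin \o rho_term)^\- m)%E.

Definition gwise_coprime (a : {ffun 'I_v -> nat}) : Prop :=
  forall i j, (i, j) \in E -> coprime (a i) (a j).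

Variables (k : nat) (A : 'I_k -> {set 'I_v}).

Definition admissible (x : R) : set {ffun 'I_v -> nat} :=
  [set a : {ffun 'I_v -> nat} | [/\ forall j, (0 < a j)%N,
               forall j, (a j)%:R <= x,
               gwise_coprime a &
               forall i, (\prod_(j in A i) a j)%N%:R <= x]].

(* Without this the [\sum_(a \in _)] below would default to 0. *)
Lemma finite_admissible x : finite_set (admissible x).
Proof.
apply: (@sub_finite_set _ _ ((fun f : {ffun 'I_v -> 'I_(Num.truncn x).+1} =>
    [ffun j => val (f j)]) @` setT)).
  move=> a [_ ax _ _]; exists [ffun j => inord (a j)] => //.
  apply/ffunP => j; rewrite !ffunE /= inordK// ltnS truncn_ge_nat//.
  by apply: le_trans (ax j); rewrite ler0n.
exact/finite_image/finite_finset.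
Qed.

Definition coprime_sum (x : R) : R :=
  \sum_(a \in admissible x) (\prod_(j < v) (a j)%:R : R)^-1.

Definition polytope : set (v.-tuple (measurableTypeR R)) :=
  [set t | (forall j, (0 : R) <= tnth t j) /\
           (forall i, \sum_(j in A i) (tnth t j : R) <= 1)].

Definition vol_polytope : R := fine (lebesgue_tuple R v polytope).

End Graph.

(* Main.v *)
Require Import Defs.
From mathcomp Require Import all_boot all_order all_algebra.
From mathcomp Require Import all_classical all_reals all_analysis.
From mathcomp Require Import measurable_realfun.
From mathcomp Require Import ring lra.

Set Implicit Arguments.
Unset Strict Implicit.
Unset Printing Implicit Defensive.

Import Order.TTheory GRing.Theory Num.Theory.
Import numFieldNormedType.Exports.

Local Open Scope classical_set_scope.
Local Open Scope ring_scope.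

(** Expanding each coprimality condition by Möbius inversion turns the sum into
    a sum over edge divisors m of (prod_i mu (m_i)) / (prod_r M_r) times
    T(M) = sum_b 1 / (b_1 ... b_v), where the points M_r b_r satisfy the product
    constraints.  With H the harmonic sums, the boxes prod_r [H(b_r - 1), H(b_r)[
    are disjoint of volume 1 / (b_1 ... b_v), and ln b <= H(b - 1),
    H(b) <= 1 + ln b; so, for L = ln x and Lam = sum_r ln M_r, their union lies
    between (L - Lam) D and (L + v) D, whence
    T(M) = vol(D) L^v + O((1 + Lam) L^(v-1)) uniformly in M.
    If n is the lcm of all the m_i, each prime power of n divides M_r at both
    ends of some edge, so n^2 divides prod_r M_r, and the total error is bounded
    by sum_m n^(-3/2) <= sum_n d(n)^e n^(-3/2), which is finite because
    d(bc) <= d(b) d(c) bounds it by the square of the same sum for e - 1.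
    The expansion is valid for m in any box [1, N]^e with N >= x, so N may tend
    to infinity for fixed x, which replaces the truncated series by rho(G). *)

(** * The Möbius function *)

Lemma mobius1 : mobius 1 = 1.
Proof. by []. Qed.

Lemma mobiusMp (p d : nat) : prime p -> (0 < d)%N -> ~~ (p %| d)%N ->
  mobius (p * d) = - mobius d.
Proof.
move=> pp d0 npd; have p0 := prime_gt0 pp.
have ppd : perm_eq (primes (p * d)) (p :: primes d).
  apply: uniq_perm; first exact: primes_uniq.
    by rewrite /= primes_uniq mem_primes pp d0 npd.
  by move=> q; rewrite primesM// primes_prime// !inE.
rewrite /mobius muln_gt0 p0 d0 /= (perm_size ppd) (perm_all _ ppd) /=.
have nlog : logn p d = 0%N by rewrite lognE pp d0 (negPf npd).
rewrite lognM// logn_prime// eqxx nlog addn0 eqxx /=.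
have -> : all (fun q => logn q (p * d) == 1%N) (primes d) =
          all (fun q => logn q d == 1%N) (primes d).
  apply: eq_in_all => q; rewrite mem_primes => /and3P[pq _ qd].
  rewrite lognM// logn_prime//; case: (eqVneq p q) => [pq'|_ //].
  by move: npd; rewrite pq' qd.
by case: ifP => _; rewrite ?exprS ?mulN1r// oppr0.
Qed.

Lemma mobius_sqr_dvd (p d : nat) : prime p -> (0 < d)%N -> (p * p %| d)%N ->
  mobius d = 0.
Proof.
move=> pp d0 ppd; rewrite /mobius d0 /=; case: allP => // /(_ p).
rewrite mem_primes pp d0 (dvdn_trans _ ppd) ?dvdn_mulr// => /(_ isT) /eqP l1.
have : (p ^ 2 %| d)%N by rewrite expnS expn1.
by rewrite pfactor_dvdn// l1.
Qed.

(** Take p the least prime factor of n > 1. Divisors divisible by p^2 contribute 0, and d -> p d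
    pairs the divisors prime to p with those divisible by p exactly once, with opposite signs. *)
Lemma sum_mobius_divisors (n : nat) : (0 < n)%N ->
  \sum_(d <- divisors n) mobius d = (n == 1)%N%:R.
Proof.
move=> n0; have [->|n1] := eqVneq n 1%N.
  by rewrite (_ : divisors 1 = [:: 1%N])// big_seq1 mobius1.
have pp : prime (pdiv n) by rewrite pdiv_prime// ltn_neqAle eq_sym n1.
have pn : (pdiv n %| n)%N := pdiv_dvd n.
move: (pdiv n) pp pn => p pp pn; have p0 := prime_gt0 pp.
rewrite (bigID (fun d => p %| d)%N) /=.
have -> : \sum_(d <- divisors n | (p %| d)%N) mobius d =
    \sum_(d <- divisors n | (p %| d)%N && ~~ (p * p %| d)%N) mobius d.
  rewrite big_seq_cond [RHS]big_seq_cond [LHS](bigID (fun d => p * p %| d)%N) /=.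
  rewrite big1 ?add0r => [|d].
    by apply: eq_bigl => d; rewrite andbA.
  rewrite -dvdn_divisors// => /andP[/andP[dn _] ppd].
  by rewrite (mobius_sqr_dvd pp)// (dvdn_gt0 n0).
rewrite -[X in X + _]big_filter.
have ppd : perm_eq
    [seq d <- divisors n | (p %| d)%N && ~~ (p * p %| d)%N]
    [seq (p * d)%N | d <- divisors n & ~~ (p %| d)%N].
  apply: uniq_perm; first by rewrite filter_uniq// divisors_uniq.
    rewrite map_inj_uniq ?filter_uniq ?divisors_uniq// => a b /eqP.
    by rewrite eqn_pmul2l// => /eqP.
  move=> d; rewrite mem_filter -dvdn_divisors//; apply/idP/mapP.
    move=> /andP[/andP[/dvdnP[c ->]]]; rewrite dvdn_pmul2r// => pc cpn.
    exists c; last by rewrite mulnC.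
    by rewrite mem_filter pc -dvdn_divisors// (dvdn_trans _ cpn)// dvdn_mulr.
  move=> [c]; rewrite mem_filter -dvdn_divisors// => /andP[pc cn] ->.
  rewrite dvdn_mulr//= dvdn_pmul2l// pc /= Gauss_dvd ?pn//.
  by rewrite prime_coprime.
rewrite (perm_big _ ppd) /= big_map big_filter -big_split big1_seq//= => d /andP[pd].
rewrite -dvdn_divisors// => dn.
by rewrite mobiusMp// ?addNr// (dvdn_gt0 n0).
Qed.

Lemma sum_mobius_ord (N n : nat) : (0 < n <= N)%N ->
  \sum_(d < N | (d.+1 %| n)%N) mobius d.+1 = (n == 1)%N%:R.
Proof.
move=> /andP[n0 nN]; rewrite -(sum_mobius_divisors n0).
rewrite -(big_mkord (fun d => (d.+1 %| n)%N) (fun d => mobius d.+1)) -big_filter.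
rewrite -(big_map succn xpredT mobius); apply: perm_big; apply: uniq_perm.
- by rewrite map_inj_uniq ?filter_uniq ?iota_uniq//; exact: succn_inj.
- exact: divisors_uniq.
move=> d; rewrite -dvdn_divisors//; apply/mapP/idP => [[c]|dn].
  by rewrite mem_filter => /andP[cn _] ->.
have d0 := dvdn_gt0 n0 dn.
exists d.-1; last by rewrite prednK.
rewrite mem_filter prednK// dn mem_index_iota /= prednK//.
exact: leq_trans (dvdn_leq n0 dn) nN.
Qed.

(** A bound on [a] alone suffices because the divisors of the gcd divide [a]. Two divisibilities
    replace the one of the gcd so that a product over edges can be regrouped by vertex. *)
Lemma coprime_mobius (N a b : nat) : (0 < a <= N)%N ->
  \sum_(d < N) ((d.+1 %| a)%N && (d.+1 %| b)%N)%:R * mobius d.+1 =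
  (coprime a b)%:R.
Proof.
move=> /andP[a0 aN]; rewrite /coprime -(@sum_mobius_ord N); last first.
  by rewrite gcdn_gt0 a0 (leq_trans _ aN)// dvdn_leq// dvdn_gcdl.
rewrite [RHS]big_mkcond /=; apply: eq_bigr => d _.
by rewrite dvdn_gcd; case: ifP => _; rewrite ?mul1r ?mul0r.
Qed.

Lemma norm_mobius_le1 (n : nat) : `|mobius n| <= 1.
Proof. by rewrite /mobius; case: ifP => _; rewrite ?normr0// normrX normrN1 expr1n. Qed.

(** * Dilations of Lebesgue measure *)

Section Dilation.
Context (R : realType).
Local Notation mR := (measurableTypeR R).
Local Notation mu := (@lebesgue_measure R).
Variables (c : R) (c0 : 0 < c).

Definition dilation n (t : n.-tuple mR) : n.-tuple mR :=
  [tuple c * tnth t i | i < n].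

Let mul_c (x : mR) : mR := c * x.

Let measurable_mul_c : measurable_fun [set: mR] mul_c.
Proof. exact: mulrl_measurable. Qed.

Lemma measurable_dilation n : measurable_fun [set: n.-tuple mR] (@dilation n).
Proof.
apply/measurable_fun_tnthP => i.
rewrite (_ : _ \o _ = mul_c \o (@tnth n mR)^~ i); last first.
  by apply/funext => t /=; rewrite tnth_mktuple.
by apply: measurableT_comp => //; exact: measurable_tnth.
Qed.

Let c_nng : {nonneg R} := NngNum (ltW c0).

(** As a function of [B] the left side is a measure that agrees with Lebesgue measure on the
    intervals ]a, b], which determine it. *)
Lemma lebesgue_dilation (B : set mR) : measurable B ->
  (c%:E * mu (( *%R c) @^-1` B) = mu B)%E.
Proof.
move=> mB; pose m := mscale c_nng
  (measure_function_pushforward__canonical__measure_function_Measure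
     mu measurable_mul_c).
suff mE X : ocitv X -> mu X = m X by rewrite [RHS](lebesgue_measure_unique mE).
move=> [[a b] _ <-] /=.
rewrite /m /mscale/= /pushforward.
rewrite (_ : mul_c @^-1` _ = `]a / c, b / c]%classic); last first.
  apply/seteqP; split=> x /=; rewrite !in_itv /= /mul_c.
    by rewrite ltr_pdivrMr// ler_pdivlMr// mulrC.
  by rewrite ltr_pdivrMr// ler_pdivlMr// mulrC.
rewrite !lebesgue_measure_itv /= !lte_fin ltr_pM2r ?invr_gt0//.
case: ifP => _; rewrite ?mule0// -!EFinD -EFinM; congr EFin.
by field; rewrite gt_eqF.
Qed.

(** In the induction step, the rescaled pushforward agrees with the product measure on rectangles,
    by the one-dimensional case and the induction hypothesis; uniqueness of the product measure
    concludes. *)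
Lemma lebesgue_tuple_dilation n (B : set (n.-tuple mR)) : measurable B ->
  ((c ^+ n)%:E * lebesgue_tuple R n (@dilation n @^-1` B) =
   lebesgue_tuple R n B)%E.
Proof.
elim: n B => [|n IH] B mB.
  have -> : @dilation 0 = id by apply/funext => t; rewrite [LHS]tuple0 [RHS]tuple0.
  by rewrite expr0 mul1e preimage_id.
have cn0 : 0 <= c ^+ n.+1 by rewrite exprn_ge0// ltW.
pose f (p : mR * n.-tuple mR) : mR * n.-tuple mR := (c * p.1, dilation p.2).
have mf : measurable_fun setT f.
  apply: measurable_fun_pair.
    by apply: (measurableT_comp measurable_mul_c); exact: measurable_fst.
  rewrite (_ : (fun x => _) = @dilation n \o snd)//.
  by apply: measurableT_comp; [exact: measurable_dilation|exact: measurable_snd].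
pose m := mscale (NngNum cn0)
  (measure_function_pushforward__canonical__measure_function_Measure
     (mu \x lebesgue_tuple R n)%E mf).
have mE X : m X = ((c ^+ n.+1)%:E * (mu \x lebesgue_tuple R n) (f @^-1` X))%E by [].
rewrite /= /leb_step /pushforward.
transitivity (m (@consp R n @^-1` B)); last first.
  symmetry; apply: product_measure_unique; last first.
    by rewrite -[X in measurable X]setTI; exact: measurable_consp.
  move=> X Y mX mY; rewrite [LHS]mE.
  have -> : f @^-1` (X `*` Y) = (( *%R c) @^-1` X) `*` (@dilation n @^-1` Y).
    by apply/seteqP; split.
  have mX' : measurable (mul_c @^-1` X).
    by rewrite -[X in measurable X]setTI; exact: measurable_mul_c.
  have mY' : measurable (@dilation n @^-1` Y).
    by rewrite -[X in measurable X]setTI; exact: measurable_dilation.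
  rewrite product_measure1E//.
  transitivity ((c%:E * mu (mul_c @^-1` X)) *
      ((c ^+ n)%:E * lebesgue_tuple R n (@dilation n @^-1` Y)))%E.
    by rewrite exprS EFinM [LHS]muleACA; exact: erefl.
  apply: f_equal2; [exact: lebesgue_dilation|exact: IH].
have consp_f p : dilation (consp p) = consp (f p).
  apply: eq_from_tnth => i; rewrite tnth_mktuple.
  by case: (unliftP ord0 i) => [j|] -> //=; rewrite !tnthS tnth_mktuple.
rewrite [RHS]mE; apply: f_equal; apply: f_equal.
by apply/seteqP; split => p; rewrite /preimage /= consp_f.
Qed.

End Dilation.

(** * Harmonic sums *)

Section Harmonic.
Context (R : realType).

Definition harm n : R := \sum_(i < n) i.+1%:R^-1.

Lemma harm0 : harm 0 = 0.
Proof. by rewrite /harm big_ord0. Qed.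

Lemma harmS n : harm n.+1 = harm n + n.+1%:R^-1.
Proof. by rewrite /harm big_ord_recr. Qed.

Lemma le_harm m n : (m <= n)%N -> harm m <= harm n.
Proof.
move=> mn; rewrite -(subnKC mn); elim: (n - m)%N => [|d IH]; first by rewrite addn0.
by rewrite addnS harmS (le_trans IH)// lerDl invr_ge0 ler0n.
Qed.

(** The logarithm grows by ln (1 + 1/(n+1)) <= 1/(n+1). *)
Lemma ln_le_harm n : ln (n.+1%:R : R) <= harm n.
Proof.
elim: n => [|n IH]; first by rewrite harm0 ln1.
rewrite harmS (_ : n.+2%:R = n.+1%:R * (1 + n.+1%:R^-1)); last first.
  by rewrite mulrDr mulr1 mulfV// -natr1.
have n0 : 0 < n.+1%:R^-1 :> R by rewrite invr_gt0 ltr0n.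
rewrite lnM ?posrE ?ltr0n ?addr_gt0// lerD// le_ln1Dx//.
by rewrite (lt_trans _ n0)// oppr_lt0.
Qed.

(** The logarithm grows by -ln (1 - 1/(n+2)) >= 1/(n+2). *)
Lemma harm_le_ln n : harm n.+1 <= 1 + ln (n.+1%:R : R).
Proof.
elim: n => [|n IH]; first by rewrite harmS harm0 ln1 invr1 add0r addr0.
have n0 : 0 < n.+2%:R^-1 :> R by rewrite invr_gt0 ltr0n.
have n1 : n.+2%:R^-1 < 1 :> R by rewrite invf_lt1 ?ltr0n// ltr1n.
have -> : ln (n.+2%:R : R) = ln n.+1%:R - ln (1 + - n.+2%:R^-1).
  have {1}-> : n.+1%:R = n.+2%:R * (1 - n.+2%:R^-1) :> R.
    by rewrite mulrBr mulr1 mulfV ?pnatr_eq0// -[n.+2%:R]natr1 addrK.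
  by rewrite lnM ?addrK ?posrE ?ltr0n ?subr_gt0.
rewrite harmS addrA lerD// lerNr le_ln1Dx// ltrN2//.
Qed.

(** By [ln_le_harm] the harmonic sums are unbounded; the least one above [t] closes the cell, and it
    is not the empty sum since [t >= 0]. *)
Lemma harm_cell (t : R) : 0 <= t -> exists n, harm n <= t < harm n.+1.
Proof.
move=> t0; have ex : exists n, t < harm n.
  exists (Num.truncn (expR t)).+1; apply: lt_le_trans (ln_le_harm _).
  rewrite -[ltLHS]expRK ltr_ln ?posrE ?expR_gt0 ?ltr0n//.
  by apply: lt_le_trans (truncnS_gt _) _; rewrite ler_nat.
have := ex_minnP ex; case=> [[|n]] tn min; first by move: tn; rewrite harm0 ltNge t0.
exists n; rewrite tn andbT leNgt; apply/negP => /min.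
by rewrite ltnn.
Qed.

Lemma harm_cell_inj (t : R) m n :
  harm m <= t < harm m.+1 -> harm n <= t < harm n.+1 -> m = n.
Proof.
suff le a b : harm a <= t -> t < harm b.+1 -> (a <= b)%N.
  by move=> /andP[m1 m2] /andP[n1 n2]; apply/eqP; rewrite eqn_leq !le.
move=> at_ tb; rewrite leqNgt; apply/negP => ba.
by have := lt_le_trans tb (le_trans (le_harm ba) at_); rewrite ltxx.
Qed.

Lemma ln_prod (I : finType) (P : pred I) (f : I -> nat) :
  (forall i, P i -> (0 < f i)%N) ->
  ln ((\prod_(i | P i) f i)%N%:R : R) = \sum_(i | P i) ln ((f i)%:R).
Proof.
move=> f0; suff [] : (0 < \prod_(i | P i) f i)%N /\
  ln ((\prod_(i | P i) f i)%N%:R : R) = \sum_(i | P i) ln ((f i)%:R) by [].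
elim/big_rec2: _ => [|i y p Pi [p0 <-]]; first by rewrite ln1.
by rewrite muln_gt0 p0 f0// natrM lnM// posrE ltr0n ?f0.
Qed.

End Harmonic.

(** A mean value bound, used to compare (L + v)^v and (L - Lam)^v with L^v. *)
Lemma exprB_le (R : realDomainType) (a b : R) n : 0 <= a -> a <= b ->
  b ^+ n.+1 - a ^+ n.+1 <= n.+1%:R * (b - a) * b ^+ n.
Proof.
move=> a0 ab; elim: n => [|n IH]; first by rewrite !expr1 expr0 mul1r mulr1.
have b0 := le_trans a0 ab.
have -> : b ^+ n.+2 - a ^+ n.+2 =
    b * (b ^+ n.+1 - a ^+ n.+1) + (b - a) * a ^+ n.+1 by rewrite !exprS; ring.
have -> : n.+2%:R * (b - a) * b ^+ n.+1 =
    b * (n.+1%:R * (b - a) * b ^+ n) + (b - a) * b ^+ n.+1.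
  by rewrite -[n.+2%:R]natr1 exprS; ring.
by rewrite lerD ?ler_wpM2l ?subr_ge0 ?lerXn2r ?nnegrE.
Qed.

(** * Counting lattice points by volume *)

Section Volume.
Context (R : realType) (v k : nat) (A : 'I_k -> {set 'I_v}).
Hypothesis hA : (\bigcup_(i < k) A i)%SET = [set: 'I_v]%SET.
Local Notation mR := (measurableTypeR R).
Local Notation vol := (vol_polytope R A).
Local Notation leb := (lebesgue_tuple R v).

Definition scaled_polytope (c : R) : set (v.-tuple mR) :=
  [set t | (forall j, (0 : R) <= tnth t j) /\
           (forall i, \sum_(j in A i) (tnth t j : R) <= c)].

Lemma in_some_A (r : 'I_v) : exists i, r \in A i.
Proof.
have : r \in (\bigcup_(i < k) A i)%SET by rewrite hA inE.
by move=> /bigcupP[i _ ri]; exists i.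
Qed.

Lemma measurable_scaled_polytope c : measurable (scaled_polytope c).
Proof.
rewrite (_ : scaled_polytope c =
  (\bigcap_(j in [set: 'I_v]) ((@tnth v mR)^~ j @^-1` `[0, +oo[%classic)) `&`
  (\bigcap_(i in [set: 'I_k])
     ((fun t : v.-tuple mR => \sum_(j <- enum (A i)) (tnth t j : R)) @^-1`
       `]-oo, c]%classic))).
  apply: measurableI.
    apply: fin_bigcap_measurable => // j _.
    rewrite -[X in measurable X]setTI.
    by apply: measurable_tnth => //; exact: measurable_itv.
  apply: fin_bigcap_measurable => // i _.
  rewrite -[X in measurable X]setTI.
  have mf : measurable_fun [set: v.-tuple mR]
      (fun t : v.-tuple mR => \sum_(j <- enum (A i)) (tnth t j : R)).
    by apply: measurable_sum => j; exact: measurable_tnth.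
  by apply: mf => //; exact: measurable_itv.
apply/seteqP; split=> t /= [t0 tc]; split.
- by move=> j _ /=; rewrite in_itv /= andbT.
- by move=> i _ /=; rewrite in_itv /= big_enum /=.
- by move=> j; have := t0 j I; rewrite /= in_itv /= andbT.
- by move=> i; have := tc i I; rewrite /= in_itv /= big_enum.
Qed.

(** The sets [A i] cover all vertices, so the polytope lies in the unit cube. Finiteness matters
    because [fine] sends an infinite value to 0. *)
Lemma polytope_fin_num : leb (polytope A) \is a fin_num.
Proof.
have mP : measurable (polytope A) := measurable_scaled_polytope 1.
rewrite ge0_fin_numE; last exact: measure_ge0.
have mB (i : 'I_v) : measurable (`[0, 1]%classic : set mR) by exact: measurable_itv.
apply: (@le_lt_trans _ _ (leb [set t | forall i, `[0, 1]%classic (tnth t i)])).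
  apply: le_measure; rewrite ?inE//.
    rewrite (_ : [set t | _] =
        \bigcap_(i in [set: 'I_v]) ((@tnth v mR)^~ i @^-1` `[0, 1]%classic)).
      apply: fin_bigcap_measurable => // i _.
      by rewrite -[X in measurable X]setTI; exact: measurable_tnth.
    by apply/seteqP; split=> [t Bt i _|t Bt i]; [exact: Bt|exact: (Bt i)].
  move=> t [t0 t1] r /=; rewrite in_itv /= t0 /=.
  have [i ri] := in_some_A r; apply: le_trans (t1 i).
  by rewrite (bigD1 r)//= lerDl sumr_ge0.
rewrite [ltLHS](@lebesgue_tuple_box R v (fun=> `[0, 1]%classic) mB).
rewrite big1 ?ltry// => i _.
by rewrite lebesgue_measure_itv /= lte_fin ltr01 sube0.
Qed.

Lemma vol_polytope_ge0 : 0 <= vol.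
Proof. by rewrite /vol_polytope fine_ge0//; exact: measure_ge0. Qed.

Lemma scaled_polytope_vol c : 0 < c ->
  leb (scaled_polytope c) = (c ^+ v * vol)%:E.
Proof.
move=> c0; rewrite -(lebesgue_tuple_dilation c0 (measurable_scaled_polytope c)).
rewrite EFinM /vol_polytope fineK; last exact: polytope_fin_num.
apply: f_equal; apply: f_equal; rewrite /polytope.
apply/seteqP; split=> t [t0 tc]; split.
- by move=> j; have := t0 j; rewrite tnth_mktuple pmulr_rge0.
- move=> i; have := tc i; under eq_bigr do rewrite tnth_mktuple.
  by rewrite -mulr_sumr -ler_pdivlMl// mulVf ?gt_eqF.
- by move=> j; rewrite tnth_mktuple mulr_ge0// ltW.
- move=> i; under eq_bigr do rewrite tnth_mktuple.
  by rewrite -mulr_sumr -ler_pdivlMl// mulVf ?gt_eqF.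
Qed.

Section Lattice.
Variables (x : R) (N : nat) (M : 'I_v -> nat).
Hypothesis M_gt0 : forall r, (0 < M r)%N.

Definition lattice_point (a : {ffun 'I_v -> 'I_N}) : bool :=
  [forall r, M r %| (a r).+1]%N &&
  [forall i, (\prod_(j in A i) (a j).+1)%N%:R <= x].

(** With [(a r).+1 = M r * b_r] each factor is 1 / b_r, so this is T(M); the ordinals below [N]
    encode the values 1, ..., N. *)
Definition lattice_sum : R :=
  \sum_(a | lattice_point a) \prod_(r < v) ((M r)%:R / (a r).+1%:R).

Let quo (a : {ffun 'I_v -> 'I_N}) r := ((a r).+1 %/ M r)%N.

(* Side [r] of the cell of [a] has length [M r / a r], so that the cells of
   distinct lattice points are disjoint and their volumes are the summands. *)
Let cell (a : {ffun 'I_v -> 'I_N}) : set (v.-tuple mR) :=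
  [set t | forall r,
    (`[harm R (quo a r).-1, harm R (quo a r)[%classic : set mR) (tnth t r)].

Let lattice_dvd a r : lattice_point a -> (M r %| (a r).+1)%N.
Proof. by move=> /andP[/forallP]. Qed.

Let quo_gt0 a r : lattice_point a -> (0 < quo a r)%N.
Proof. by move=> ok; rewrite divn_gt0// dvdn_leq// lattice_dvd. Qed.

Let measurable_cell a : measurable (cell a).
Proof.
rewrite (_ : cell a = \bigcap_(r in [set: 'I_v]) ((@tnth v mR)^~ r @^-1`
    `[harm R (quo a r).-1, harm R (quo a r)[%classic)).
  apply: fin_bigcap_measurable => // r _.
  by rewrite -[X in measurable X]setTI; apply: measurable_tnth.
by apply/seteqP; split=> [t Bt r _|t Bt r]; [exact: Bt|exact: (Bt r)].
Qed.

Let cell_vol a : lattice_point a ->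
  leb (cell a) = (\prod_(r < v) ((M r)%:R / (a r).+1%:R))%:E.
Proof.
move=> ok; rewrite [LHS](@lebesgue_tuple_box R v
  (fun r => `[harm R (quo a r).-1, harm R (quo a r)[%classic)); last first.
  by move=> r; exact: measurable_itv.
rewrite (big_morph EFin EFinM erefl); apply: eq_bigr => r _.
have q0 := quo_gt0 r ok; have aE : (a r).+1 = (quo a r * M r)%N.
  by rewrite divnK// lattice_dvd.
rewrite lebesgue_measure_itv /= lte_fin -(prednK q0) harmS prednK//.
have qi0 : 0 < (quo a r)%:R^-1 :> R by rewrite invr_gt0 ltr0n.
rewrite ltrDl qi0 -EFinB addrAC subrr add0r; congr EFin.
by rewrite aE natrM invfM mulrCA mulfV ?mulr1// pnatr_eq0 -lt0n.
Qed.

Let cells := \bigcup_(a in [set` lattice_point]) cell a.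

Let sum_measure_cells :
  (\sum_(a \in [set` lattice_point]) leb (cell a) = lattice_sum%:E)%E.
Proof.
rewrite -(bigfs _ (r := index_enum _))//; last 2 first.
- exact: index_enum_uniq.
- by move=> a _; rewrite mem_index_enum.
rewrite /lattice_sum (big_morph EFin EFinD erefl).
by apply: eq_bigr => a; exact: cell_vol.
Qed.

Let measure_cells : leb cells = lattice_sum%:E.
Proof.
rewrite -sum_measure_cells; apply: measure_fin_bigcup => //.
apply/trivIsetP => a b /= oka okb ab; apply/seteqP; split=> // t [at_ bt].
(* A common point of two cells determines every quotient b_r, and M_r b_r recovers the lattice
   point. *)
apply: (elimN eqP ab); apply/ffunP => r; apply: val_inj => /=.
apply: succn_inj; rewrite -(divnK (lattice_dvd r oka)) -(divnK (lattice_dvd r okb)).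
congr (_ * _)%N; have qa := quo_gt0 r oka; have qb := quo_gt0 r okb.
have := at_ r; have := bt r; rewrite /= !in_itv /= -/(quo a r) -/(quo b r).
rewrite -(prednK qa) -(prednK qb) /= => h1 h2; congr succn.
exact: harm_cell_inj h2 h1.
Qed.

(** In a cell t_j < H(b_j) <= 1 + ln b_j <= 1 + ln (M_j b_j), and summing over [A i] gives at most
    ln x + v. *)
Lemma lattice_sum_upper : 1 < x -> lattice_sum <= (ln x + v%:R) ^+ v * vol.
Proof.
move=> x1; have Lv : 0 < ln x + v%:R by rewrite ltr_pwDl// ln_gt0.
rewrite -lee_fin -measure_cells -(scaled_polytope_vol Lv).
apply: le_measure; rewrite ?inE.
- by apply: fin_bigcup_measurable.
- exact: measurable_scaled_polytope.
move=> t [a /= ok ta]; split=> [r|i].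
  by have := ta r; rewrite /= in_itv /= => /andP[+ _]; apply: le_trans;
    rewrite -(harm0 R) le_harm.
apply: (@le_trans _ _ (\sum_(j in A i) (1 + ln ((a j).+1%:R)))).
  apply: ler_sum => j _; have q0 := quo_gt0 j ok.
  have := ta j; rewrite /= in_itv /= => /andP[_ /ltW]; move/le_trans; apply.
  rewrite -(prednK q0); apply: le_trans (harm_le_ln _ _) _.
  rewrite lerD2l prednK// ler_ln ?posrE ?ltr0n// ler_nat.
  exact: leq_div.
rewrite big_split /= -ln_prod// sumr_const addrC lerD//.
  move: ok => /andP[_ /forallP /(_ i)] ok.
  by rewrite ler_ln ?posrE ?ltr0n ?prodn_gt0// (lt_trans ltr01).
by rewrite ler_nat (leq_trans (max_card _))// card_ord.
Qed.

(** Each t in the scaled polytope lies in the cell of some b with ln b_r <= t_r. Over [A i] the sum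
    of ln (M_j b_j) is then at most (ln x - Lam) + Lam, so the product bounds hold. *)
Lemma lattice_sum_lower : x <= N%:R -> 0 < x ->
  \sum_(r < v) ln ((M r)%:R : R) < ln x ->
  (ln x - \sum_(r < v) ln ((M r)%:R : R)) ^+ v * vol <= lattice_sum.
Proof.
move=> xN x0 Mx; have c0 : 0 < ln x - \sum_(r < v) ln ((M r)%:R : R).
  by rewrite subr_gt0.
rewrite -lee_fin -(scaled_polytope_vol c0) -measure_cells.
have lnM0 r : 0 <= ln ((M r)%:R : R) by rewrite ln_ge0// ler1n.
apply: le_measure; rewrite ?inE.
- exact: measurable_scaled_polytope.
- by apply: fin_bigcup_measurable.
move=> t [t0 tc].
have [b bt] := choice (fun r => harm_cell (t0 r)).
have lnb r : ln ((b r).+1%:R : R) <= tnth t r.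
  by apply: le_trans (ln_le_harm _ _) _; case/andP: (bt r).
have bA i : (\prod_(j in A i) ((b j).+1 * M j))%N%:R <= x.
  have p0 j : (0 < (b j).+1 * M j)%N by rewrite muln_gt0 M_gt0.
  rewrite -ler_ln ?posrE// ?ltr0n ?prodn_gt0// ln_prod//.
  under eq_bigr => j _ do rewrite natrM lnM ?posrE ?ltr0n//.
  rewrite big_split /= -lerBrDr.
  apply: le_trans (ler_sum _ (fun j _ => lnb j)) _; apply: le_trans (tc i) _.
  rewrite lerB//; rewrite [leRHS](bigID (mem (A i))) /= lerDl sumr_ge0//.
(* Every vertex lies in some [A i], so the product bound there also bounds the single entry by x <=
   N, making it a valid index. *)
have bN r : ((b r).+1 * M r <= N)%N.
  have [i ri] := in_some_A r; rewrite -(ler_nat R); apply: le_trans xN.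
  apply: le_trans (bA i); rewrite ler_nat (bigD1 r)//= leq_pmulr// prodn_gt0//.
  by move=> j; rewrite muln_gt0 M_gt0.
have aN r : (((b r).+1 * M r).-1 < N)%N.
  by rewrite prednK ?bN// muln_gt0 M_gt0.
pose a : {ffun 'I_v -> 'I_N} := [ffun r => Ordinal (aN r)].
have aE r : (a r).+1 = ((b r).+1 * M r)%N.
  by rewrite ffunE /= prednK// muln_gt0 M_gt0.
exists a.
  apply/andP; split; first by apply/forallP => r; rewrite aE dvdn_mull.
  by apply/forallP => i; under eq_bigr => j _ do rewrite aE.
by move=> r /=; rewrite in_itv /= /quo aE mulnK//; exact: bt.
Qed.

Lemma lattice_sum_ge0 : 0 <= lattice_sum.
Proof.
by apply: sumr_ge0 => a _; apply: prodr_ge0 => r _; rewrite divr_ge0.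
Qed.

Lemma lattice_sum_approx : (0 < v)%N -> 1 <= ln x -> x <= N%:R ->
  `|lattice_sum - vol * ln x ^+ v| <=
  vol * (v%:R * v.+1%:R ^+ v) * (1 + \sum_(r < v) ln ((M r)%:R : R))
    * ln x ^+ v.-1.
Proof.
move=> v0 L1 xN.
have L0 : 0 < ln x := lt_le_trans ltr01 L1.
have x0 : 0 < x by rewrite ltNge; apply: contraL L0 => x0; rewrite -leNgt ln0.
have x1 : 1 < x by move: L0; rewrite -{1}(@ln1 R) ltr_ln ?posrE.
set Lam := \sum_(r < v) _; set L := ln x in L1 L0 *.
have Lam0 : 0 <= Lam by apply: sumr_ge0 => r _; rewrite ln_ge0// ler1n.
have volge0 := vol_polytope_ge0.
have Ln0 n : 0 <= L ^+ n by rewrite exprn_ge0// ltW.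
(* The constant w = v (v+1)^v dominates v * v * (v+1)^(v-1), which comes from [exprB_le] at distance
   v together with L + v <= (v+1) L. *)
set w := v%:R * _.
have w1 : v%:R <= w.
  by rewrite ler_peMr// exprn_ege1// ler1n.
have [n vE] : exists n, v = n.+1 by exists v.-1; rewrite prednK.
have up : (L + v%:R) ^+ v <= L ^+ v + w * L ^+ v.-1.
  rewrite -lerBlDl /w; have vn : v.-1 = n by rewrite vE.
  have := @exprB_le _ L (L + v%:R) n (ltW L0); rewrite lerDl ler0n => /(_ isT).
  rewrite -vE vn => /le_trans; apply; rewrite addrAC subrr add0r.
  have Lv : (L + v%:R) ^+ n <= (v.+1%:R * L) ^+ n.
    rewrite lerXn2r ?nnegrE ?addr_ge0 ?mulr_ge0 ?(ltW L0)//.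
    by rewrite -natr1 mulrDl mul1r addrC lerD2r ler_peMr.
  apply: le_trans (ler_wpM2l _ Lv) _; first by rewrite mulr_ge0.
  have -> : v.+1%:R ^+ v = v.+1%:R * v.+1%:R ^+ n :> R by rewrite -exprS -vE.
  rewrite exprMn [leLHS]mulrA ler_wpM2r// -[leLHS]mulrA ler_wpM2l//.
  by rewrite ler_wpM2r ?exprn_ge0// ler_nat.
clearbody w.
have lo : vol * L ^+ v - vol * w * Lam * L ^+ v.-1 <= lattice_sum.
  (* If Lam >= L the claimed error already exceeds the main term, and [lattice_sum] is
     nonnegative. *)
  have [LamL|LLam] := ltP Lam L; last first.
    apply: le_trans lattice_sum_ge0; rewrite subr_le0 -!mulrA ler_wpM2l//.
    have -> : L ^+ v = L * L ^+ v.-1 by rewrite -exprS prednK.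
    rewrite [leRHS]mulrA ler_wpM2r//.
    apply: le_trans LLam _; rewrite ler_peMl//; apply: le_trans w1.
    by rewrite ler1n.
  apply: le_trans (lattice_sum_lower xN x0 LamL); rewrite -/Lam -/L.
  rewrite [leRHS]mulrC -!mulrA -mulrBr ler_wpM2l// lerBlDl -lerBlDr mulrA.
  have vn : v.-1 = n by rewrite vE.
  have := @exprB_le _ (L - Lam) L n; rewrite subr_ge0 gerBl (ltW LamL) Lam0.
  move=> /(_ isT isT); rewrite -vE vn => /le_trans; apply.
  rewrite opprB addrCA subrr addr0 ler_wpM2r// ler_wpM2r//.
have := lattice_sum_upper x1; rewrite -/L => hi.
have {}hi : lattice_sum <= (L ^+ v + w * L ^+ v.-1) * vol.
  by apply: le_trans hi _; rewrite ler_wpM2r.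
have w0 : 0 <= w by apply: le_trans w1.
have p1 : 0 <= vol * w * Lam * L ^+ v.-1 by rewrite !mulr_ge0.
have p2 : 0 <= vol * w * L ^+ v.-1 by rewrite !mulr_ge0.
by rewrite ler_norml; apply/andP; split; lra.
Qed.

End Lattice.

End Volume.

(** * Sums over least common multiples *)

(** Each divisor c of a b factors as g * (c / g) with g = gcd(c, a); here c / g divides b because it
    divides (a / g) b and is coprime to a / g. *)
Lemma size_divisorsM (a b : nat) : (0 < a)%N -> (0 < b)%N ->
  (size (divisors (a * b)) <= size (divisors a) * size (divisors b))%N.
Proof.
move=> a0 b0; rewrite -(size_allpairs muln).
apply: uniq_leq_size; first exact: divisors_uniq.
move=> c; rewrite -dvdn_divisors ?muln_gt0 ?a0// => cab.
apply/allpairsP; exists (gcdn c a, c %/ gcdn c a)%N => /=.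
rewrite -!dvdn_divisors// dvdn_gcdr mulnC divnK ?dvdn_gcdl//; split=> //.
have g0 : (0 < gcdn c a)%N by rewrite gcdn_gt0 a0 orbT.
rewrite -(@Gauss_dvdr _ (a %/ gcdn c a)).
  by rewrite -(dvdn_pmul2l g0) mulnA !(mulnC (gcdn c a)) !divnK ?dvdn_gcdl ?dvdn_gcdr.
rewrite /coprime -(eqn_pmul2r g0) muln_gcdl !divnK ?dvdn_gcdl ?dvdn_gcdr//.
by rewrite mul1n.
Qed.

Lemma sum_dvd_ordE (X n : nat) :
  (\sum_(c < X) (c.+1 %| n)%N)%N = size [seq c <- iota 0 X | c.+1 %| n]%N.
Proof.
rewrite size_filter -sum1_count -(big_mkord xpredT (fun c => nat_of_bool (c.+1 %| n)))%N.
rewrite /index_iota subn0 [RHS]big_mkcond.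
by apply: eq_bigr => c _; case: ifP.
Qed.

Lemma sum_dvd_ord_le (X n : nat) : (0 < n)%N ->
  (\sum_(c < X) (c.+1 %| n)%N <= size (divisors n))%N.
Proof.
move=> n0; rewrite sum_dvd_ordE -(size_map succn); apply: uniq_leq_size.
  by rewrite map_inj_uniq ?filter_uniq ?iota_uniq//; exact: succn_inj.
move=> _ /mapP[c + ->]; rewrite mem_filter => /andP[cn _].
by rewrite -dvdn_divisors.
Qed.

Lemma size_divisors_le (X n : nat) : (0 < n <= X)%N ->
  (size (divisors n) <= \sum_(c < X) (c.+1 %| n)%N)%N.
Proof.
move=> /andP[n0 nX]; rewrite sum_dvd_ordE -[leqRHS](size_map succn); apply: uniq_leq_size.
  exact: divisors_uniq.
move=> c; rewrite -dvdn_divisors// => cn; have c0 := dvdn_gt0 n0 cn.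
apply/mapP; exists c.-1; last by rewrite prednK.
by rewrite mem_filter prednK// cn mem_iota /= add0n prednK// (leq_trans (dvdn_leq n0 cn)).
Qed.

Section LcmSum.
Context (R : realType).

Definition inv_pow32 (n : nat) : R := (n%:R * Num.sqrt n%:R)^-1.

Lemma inv_pow32_ge0 n : 0 <= inv_pow32 n.
Proof. by rewrite invr_ge0 mulr_ge0// sqrtr_ge0. Qed.

Lemma inv_pow32M m n : inv_pow32 (m * n) = inv_pow32 m * inv_pow32 n.
Proof. by rewrite /inv_pow32 natrM sqrtrM// mulrACA invfM. Qed.

Lemma sum_inv_pow32_le3 X : \sum_(i < X) inv_pow32 i.+1 <= 3.
Proof.
case: X => [|X]; first by rewrite big_ord0.
(* The stronger bound makes the induction work: its last term telescopes like the integral of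
   n^(-3/2). *)
suff : \sum_(i < X.+1) inv_pow32 i.+1 <= 3 - 2 / Num.sqrt X.+1%:R.
  by move=> /le_trans; apply; rewrite gerBl divr_ge0// sqrtr_ge0.
elim: X => [|X IH].
  by rewrite big_ord_recr big_ord0 /= /inv_pow32 sqrtr1 mulr1 invr1; lra.
rewrite big_ord_recr /=; apply: le_trans (lerD IH (lexx _)) _.
rewrite /inv_pow32; set s := Num.sqrt X.+1%:R; set t := Num.sqrt X.+2%:R.
have s0 : 0 < s by rewrite sqrtr_gt0.
have t0 : 0 < t by rewrite sqrtr_gt0.
have tt : t ^+ 2 = s ^+ 2 + 1 by rewrite !sqr_sqrtr// natr1.
rewrite -[X.+2%:R]sqr_sqrtr// -/t -exprSr.
have st : s <= t by rewrite ler_sqrt// ler_nat.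
(* The claim is 1/t^3 <= 2/s - 2/t; as t - s = 1/(t + s), it reduces to s t (t + s) <= 2 t^3. *)
rewrite -subr_ge0 (_ : _ - _ = (2 * t ^+ 3 * (t - s) - s * t) / (s * t ^+ 4)).
  apply: divr_ge0; last by rewrite mulr_ge0 ?exprn_ge0 ?ltW.
  have E : (t - s) * (t + s) = 1.
    by rewrite -subr_sqr tt addrAC subrr add0r.
  have t1 : 0 < t + s by rewrite addr_gt0.
  rewrite subr_ge0 -(ler_pM2r t1) -[leRHS]mulrA E mulr1.
  have -> : 2 * t ^+ 3 = t * t * (t + t) by ring.
  by apply: ler_pM; rewrite ?mulr_ge0 ?ler_wpM2r ?lerD2l// ltW.
by field; rewrite !gt_eqF.
Qed.

Definition divisor_sum e X : R :=
  \sum_(i < X) (size (divisors i.+1))%:R ^+ e * inv_pow32 i.+1.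

Lemma divisor_sum_ge0 e X : 0 <= divisor_sum e X.
Proof. by apply: sumr_ge0 => i _; rewrite mulr_ge0 ?exprn_ge0 ?inv_pow32_ge0. Qed.

(* Writing one factor [d n] as the number of factorisations [n = b c] and using
   [d (b c) <= d b * d c] in the others. *)
Lemma divisor_sumS e X : divisor_sum e.+1 X <= divisor_sum e X ^+ 2.
Proof.
pose F n : R := (size (divisors n))%:R ^+ e * inv_pow32 n.
have F0 n : 0 <= F n by rewrite mulr_ge0 ?exprn_ge0 ?inv_pow32_ge0.
apply: (@le_trans _ _ (\sum_(i < X) \sum_(c < X) \sum_(b < X)
   ((c.+1 * b.+1 == i.+1)%N)%:R * F i.+1)).
  apply: ler_sum => i _; rewrite exprS -mulrA -/(F i.+1).
  under eq_bigr do rewrite -mulr_suml.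
  rewrite -mulr_suml ler_wpM2r//.
  apply: (@le_trans _ _ (\sum_(c < X) (c.+1 %| i.+1)%N)%N%:R).
    by rewrite ler_nat size_divisors_le//=.
  rewrite natr_sum; apply: ler_sum => c _.
  case: (boolP (c.+1 %| i.+1)%N) => [/dvdnP[b bE]|_]; last exact: sumr_ge0.
  have b0 : (0 < b)%N by case: b bE.
  have bX : (b.-1 < X)%N.
    by rewrite prednK// (leq_trans _ (ltn_ord i))// bE leq_pmulr.
  rewrite (bigD1 (Ordinal bX))//= prednK// bE mulnC eqxx lerDl.
  exact: sumr_ge0.
(* For fixed factors at most one index i survives, and none if their product exceeds X. *)
rewrite exchange_big expr2 {1}/divisor_sum mulr_suml /=; apply: ler_sum => c _.
rewrite exchange_big /divisor_sum mulr_sumr /=; apply: ler_sum => b _.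
apply: (@le_trans _ _ (F (c.+1 * b.+1)%N)).
  have [q ->] : exists q, (c.+1 * b.+1)%N = q.+1.
    by exists (c.+1 * b.+1).-1; rewrite prednK ?muln_gt0.
  case: (boolP (q < X)%N) => [lt|nlt].
    rewrite (bigD1 (Ordinal lt))//= eqxx mul1r big1 ?addr0//.
    move=> i ne; case: eqP => [[E]|_]; last by rewrite mul0r.
    by move: ne; rewrite -val_eqE /= E eqxx.
  rewrite big1// => i _; case: eqP => [[E]|_]; last by rewrite mul0r.
  by move: nlt; rewrite E ltn_ord.
rewrite /F inv_pow32M mulrACA ler_wpM2r ?mulr_ge0 ?inv_pow32_ge0//.
rewrite -exprMn lerXn2r ?nnegrE ?mulr_ge0// -natrM ler_nat.
exact: size_divisorsM.
Qed.

(** Each further divisor factor squares the initial bound 3. *)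
Lemma divisor_sum_bounded e X : divisor_sum e X <= 3 ^+ (2 ^ e).
Proof.
elim: e => [|e IH].
  apply: le_trans (sum_inv_pow32_le3 X); apply: ler_sum => i _.
  by rewrite expr0 mul1r.
apply: le_trans (divisor_sumS _ _) _.
by rewrite expnSr exprM lerXn2r ?nnegrE ?divisor_sum_ge0.
Qed.

(** Families are grouped by their lcm n; all entries divide n, so there are at most d(n)^e of
    them. *)
Lemma sum_inv_pow32_lcm e N :
  \sum_(m : {ffun 'I_e -> 'I_N}) inv_pow32 (\big[lcmn/1%N]_(i < e) (m i).+1) <=
  3 ^+ (2 ^ e).
Proof.
pose l (m : {ffun 'I_e -> 'I_N}) := \big[lcmn/1%N]_(i < e) (m i).+1.
(* This range contains every lcm that occurs; the bound on [divisor_sum] does not depend on it. *)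
pose X := \max_m l m.
have l0 m : (0 < l m)%N.
  by rewrite /l; elim/big_ind: _ => // a b a0 b0; rewrite lcmn_gt0 a0.
apply: le_trans (divisor_sum_bounded e X).
apply: (@le_trans _ _ (\sum_(m : {ffun 'I_e -> 'I_N}) \sum_(i < X)
    (l m == i.+1)%:R * inv_pow32 i.+1)).
  apply: ler_sum => m _; rewrite -/(l m).
  have lX : ((l m).-1 < X)%N by rewrite prednK// (leq_bigmax m).
  rewrite (bigD1 (Ordinal lX))//= prednK// eqxx mul1r lerDl sumr_ge0// => i _.
  by rewrite mulr_ge0 ?inv_pow32_ge0.
rewrite exchange_big /=; apply: ler_sum => n _; rewrite -mulr_suml.
rewrite ler_wpM2r ?inv_pow32_ge0// -natr_sum -natrX ler_nat.
apply: (@leq_trans (\sum_(m : {ffun 'I_e -> 'I_N})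
    \prod_(i < e) ((m i).+1 %| n.+1))%N).
  apply: leq_sum => m _; case: eqP => // ln; rewrite big1// => i _.
  by rewrite -ln (biglcmn_sup i).
rewrite -(bigA_distr_bigA (fun (i : 'I_e) (c : 'I_N) => nat_of_bool (c.+1 %| n.+1)%N)).
rewrite prod_nat_const card_ord /=.
have [->//|e0] := posnP e; rewrite leq_exp2r//.
exact: sum_dvd_ord_le.
Qed.

End LcmSum.

(** * Positive integer families in a box *)

Definition shift_ffun (I : finType) N (b : {ffun I -> 'I_N}) : {ffun I -> nat} :=
  [ffun i => (b i).+1].

(** This carries sums over sets of positive families over to a finite index type, where they can be
    exchanged and compared. *)
Lemma fsbig_shift (T : Type) (idx : T) (op : Monoid.com_law idx) (I : finType)
    N (D : set {ffun I -> nat}) (F : {ffun I -> nat} -> T) :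
    (forall a, D a -> forall i, (0 < a i <= N)%N) ->
  \big[op/idx]_(a \in D) F a =
  \big[op/idx]_(b : {ffun I -> 'I_N} | shift_ffun b \in D) F (shift_ffun b).
Proof.
move=> DN; set r := [seq shift_ffun b | b <- index_enum {ffun I -> 'I_N} &
  shift_ffun b \in D].
have rD a : a \in r -> D a.
  by move=> /mapP[b]; rewrite mem_filter => /andP[/set_mem Db _] ->.
rewrite (fsbigE r).
- rewrite big_seq_cond (eq_bigl (mem r)); last first.
    move=> a /=; rewrite andb_idr// => /rD ?; exact: mem_set.
  by rewrite -big_seq big_map big_filter.
- rewrite map_inj_uniq ?filter_uniq ?index_enum_uniq// => b c /ffunP bc.
  apply/ffunP => i; apply: val_inj => /=.
  by have := bc i; rewrite !ffunE => -[].
- by move=> a; exact: rD.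
- move=> a Da; rewrite -topredE /= => /negP[]; apply/mapP.
  have aN i : ((a i).-1 < N)%N by have /andP[a0 ?] := DN a Da i; rewrite prednK.
  have aE : a = shift_ffun [ffun i => Ordinal (aN i)].
    apply/ffunP => i; rewrite !ffunE /= prednK//.
    by have /andP[] := DN a Da i.
  exists [ffun i => Ordinal (aN i)] => //.
  by rewrite mem_filter mem_index_enum -aE mem_set.
Qed.

Section BoxSums.
Context (R : realType) (I : finType).
Variables (h : {ffun I -> nat} -> R) (K : R).
Hypothesis h_ge0 : forall m, 0 <= h m.

Definition box_sum (f : {ffun I -> nat} -> R) N : R :=
  \sum_(m : {ffun I -> 'I_N}) f (shift_ffun m).

Hypothesis h_bounded : forall N, box_sum h N <= K.

Local Notation P := [set m : {ffun I -> nat} | forall i, (0 < m i)%N].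

Lemma fsum_le_box_sum (X : set {ffun I -> nat}) : fsets P X ->
  exists N0, forall N, (N0 <= N)%N ->
    (\sum_(m \in X) (h m)%:E <= (box_sum h N)%:E)%E.
Proof.
move=> [finX XP].
have /finite_seqP[s Xs] := finX.
(* The largest entry of any family in the finite set: from there on the box contains the set. *)
exists (\max_(m <- s) \max_i m i)%N => N XN.
rewrite (@fsbig_shift _ _ _ _ N) => [|m Xm i].
  rewrite /box_sum [leRHS](big_morph EFin EFinD erefl) /=.
  rewrite big_mkcond /=; apply: lee_sum => m _.
  by case: ifP => _; rewrite lee_fin.
rewrite XP//=; apply: leq_trans XN; apply: (leq_trans (leq_bigmax i)).
have ms : m \in s by move: Xm; rewrite Xs.
exact: (@leq_bigmax_seq _ s xpredT (fun m : {ffun I -> nat} => \max_i m i)%N m ms).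
Qed.

Lemma box_sum_le_esum N : ((box_sum h N)%:E <= \esum_(m in P) (h m)%:E)%E.
Proof.
pose B := [set m : {ffun I -> nat} | forall i, (0 < m i <= N)%N].
have BE : (\sum_(m \in B) (h m)%:E = (box_sum h N)%:E)%E.
  rewrite (@fsbig_shift _ _ _ _ N)// /box_sum (big_morph EFin EFinD erefl).
  apply: eq_bigl => m; apply/mem_set => i.
  by rewrite ffunE /=.
apply: esum_ge; exists B; last by rewrite BE.
split; last by move=> m Bm i; have /andP[] := Bm i.
apply: (@sub_finite_set _ _ ((@shift_ffun I N) @` setT)); last first.
  exact/finite_image/finite_finset.
move=> m Bm; have mN i : ((m i).-1 < N)%N by have /andP[a0 ?] := Bm i; rewrite prednK.
exists [ffun i => Ordinal (mN i)] => //; apply/ffunP => i; rewrite !ffunE /= prednK//.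
by have /andP[] := Bm i.
Qed.

(** The sum is a supremum over finite sets. Boxes are such sets, and a nearly optimal finite set
    lies in all large boxes. *)
Lemma esum_box_sum : exists2 s : R, (\esum_(m in P) (h m)%:E = s%:E)%E &
  forall eps, 0 < eps -> exists N0, forall N, (N0 <= N)%N ->
    s - eps <= box_sum h N <= s.
Proof.
have fin : (\esum_(m in P) (h m)%:E)%E \is a fin_num.
  rewrite ge0_fin_numE; last by apply: esum_ge0 => m _; rewrite lee_fin.
  apply: (@le_lt_trans _ _ K%:E); last exact: ltry.
  apply: ge_ereal_sup => _ [X PX <-].
  have [N /(_ N (leqnn N)) /le_trans] := fsum_le_box_sum PX; apply.
  by rewrite lee_fin.
exists (fine (\esum_(m in P) (h m)%:E)%E); first by rewrite fineK.
move=> eps eps0; have [_ [X PX <-] Xeps] := ub_ereal_sup_adherent eps0 fin.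
have [N0 N0P] := fsum_le_box_sum PX; exists N0 => N /N0P XN.
rewrite -!lee_fin EFinB fineK// box_sum_le_esum andbT.
exact: ltW (lt_le_trans Xeps XN).
Qed.

End BoxSums.

(** * Edge divisors *)

Section Edges.
Context (R : realType) (v : nat) (E : {set 'I_v * 'I_v}).
Hypothesis hE : forall p, p \in E -> (p.1 < p.2)%N.
Implicit Types m : {ffun 'I_#|E| -> nat}.

Definition total_lcm m : nat := \big[lcmn/1%N]_(i < #|E|) m i.

Lemma biglcmn_gt0 (I : finType) (Q : pred I) (f : I -> nat) :
  (forall i, (0 < f i)%N) -> (0 < \big[lcmn/1%N]_(i | Q i) f i)%N.
Proof. by move=> f0; elim/big_ind: _ => // a b a0 b0; rewrite lcmn_gt0 a0. Qed.

Lemma edge_lcm_gt0 m r : (forall i, (0 < m i)%N) -> (0 < edge_lcm m r)%N.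
Proof. exact: biglcmn_gt0. Qed.

(** This turns the edge divisibilities of the Möbius expansion into one divisibility by M_r per
    vertex. *)
Lemma edge_lcm_dvdP m (a : 'I_v -> nat) :
  reflect (forall i, (m i %| a (enum_val i).1)%N && (m i %| a (enum_val i).2)%N)
          [forall r, edge_lcm m r %| a r]%N.
Proof.
apply: (iffP forallP) => [mr i|mi r].
  by rewrite !(dvdn_trans _ (mr _))// (biglcmn_sup i)// eqxx ?orbT.
apply/dvdn_biglcmP => i; have /andP[? ?] := mi i.
by move=> /orP[] /eqP ->.
Qed.

Lemma edge_lcm_dvd_total m r : (edge_lcm m r %| total_lcm m)%N.
Proof. by apply/dvdn_biglcmP => i _; rewrite (biglcmn_sup i). Qed.

(** The exponent of p in an lcm is a maximum, hence attained; the first alternative covers the empty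
    lcm. *)
Lemma logn_total_lcm m p : (forall i, (0 < m i)%N) ->
  logn p (total_lcm m) = 0%N \/ exists i, logn p (total_lcm m) = logn p (m i).
Proof.
move=> m0; rewrite /total_lcm; suff [] :
    (0 < \big[lcmn/1%N]_(i < #|E|) m i)%N /\
    (logn p (\big[lcmn/1%N]_(i < #|E|) m i) = 0%N \/
     exists i, logn p (\big[lcmn/1%N]_(i < #|E|) m i) = logn p (m i)) by [].
elim/big_ind: _ => [|a b [a0 pa] [b0 pb]|i _]; first by rewrite logn1; split; [|left].
  rewrite lcmn_gt0 a0 b0 logn_lcm//; split=> //.
  by case: (leqP (logn p a) (logn p b)).
by rewrite m0; split=> //; right; exists i.
Qed.

(* The largest power of a prime dividing some [m i] divides both ends of edge
   [i]. *)
Lemma sqr_total_lcm_dvd m : (forall i, (0 < m i)%N) ->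
  (total_lcm m * total_lcm m %| \prod_(r < v) edge_lcm m r)%N.
Proof.
move=> m0; have n0 : (0 < total_lcm m)%N by exact: biglcmn_gt0.
apply/dvdn_partP; first by rewrite muln_gt0 n0.
move=> p _; rewrite p_part lognM//.
have [->|[i ->]] := logn_total_lcm p m0; first exact: dvd1n.
have /hE lt12 := enum_valP i; set r := (enum_val i).1 in lt12.
set s := (enum_val i).2 in lt12.
(* The ends are distinct vertices, so the prime power occurs in two separate factors of the
   product. *)
have rs : s != r by rewrite neq_ltn lt12 orbT.
rewrite (bigD1 r)//= (bigD1 s)//= mulnA dvdn_mulr// expnD dvdn_mul//;
  apply: dvdn_trans (pfactor_dvdnn _ _) _;
  by rewrite (biglcmn_sup i)// eqxx ?orbT.
Qed.

Lemma prod_edge_lcm_gt0 m : (forall i, (0 < m i)%N) ->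
  (0 < \prod_(r < v) edge_lcm m r)%N.
Proof. by move=> m0; rewrite prodn_gt0// => r; exact: edge_lcm_gt0. Qed.

(** The term is at most n^(-2), since n^2 divides the product of the M_r, while ln M_r <= ln n <= 2
    sqrt n; the logarithms thus cost a factor sqrt n. *)
Lemma rho_term_bound m : (forall i, (0 < m i)%N) ->
  `|rho_term R m| * (1 + \sum_(r < v) ln ((edge_lcm m r)%:R : R)) <=
  (1 + 2 * v%:R) * inv_pow32 R (total_lcm m).
Proof.
move=> m0; have n0 : (0 < total_lcm m)%N by exact: biglcmn_gt0.
set n := total_lcm m in n0 *.
have nR : 0 < n%:R :> R by rewrite ltr0n.
set s : R := Num.sqrt n%:R.
have s0 : 0 < s by rewrite sqrtr_gt0.
have ss : n%:R = s * s by rewrite -expr2 sqr_sqrtr// ltW.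
have s1 : 1 <= s by rewrite -(@sqrtr1 R) ler_sqrt ?ler1n.
have lns : ln (n%:R : R) <= 2 * s.
  rewrite ss lnM ?posrE// mulrDl mul1r; suff : ln s <= s by move=> ?; rewrite lerD.
  have := @le_ln1Dx R (s - 1); rewrite addrCA subrr addr0 => /(_ _) h.
  by apply: le_trans (h _) _; lra.
have rt : `|rho_term R m| <= (n%:R * n%:R)^-1.
  rewrite /rho_term normrM normfV [X in _ / X]ger0_norm// -intr_norm normr_prod.
  apply: (@le_trans _ _ (1 * (\prod_(r < v) edge_lcm m r)%N%:R^-1)).
    rewrite ler_wpM2r ?invr_ge0// (_ : 1 = 1%:~R)// ler_int.
    by rewrite prodr_ile1// => i _; rewrite normr_ge0 norm_mobius_le1.
  rewrite mul1r lef_pV2 ?posrE ?mulr_gt0 ?ltr0n ?prod_edge_lcm_gt0// -natrM ler_nat.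
  by rewrite dvdn_leq ?prod_edge_lcm_gt0// sqr_total_lcm_dvd.
have lnr : \sum_(r < v) ln ((edge_lcm m r)%:R : R) <= v%:R * (2 * s).
  rewrite -[v in v%:R]card_ord -sum1_card natr_sum mulr_suml ler_sum// => r _.
  rewrite mul1r; apply: le_trans lns.
  rewrite ler_ln ?posrE ?ltr0n ?edge_lcm_gt0// ler_nat dvdn_leq//.
  exact: edge_lcm_dvd_total.
have ln0 : 0 <= \sum_(r < v) ln ((edge_lcm m r)%:R : R).
  by apply: sumr_ge0 => r _; rewrite ln_ge0// ler1n edge_lcm_gt0.
apply: le_trans (ler_pM _ _ rt (_ : _ <= (1 + 2 * v%:R) * s)) _ => //.
- by rewrite addr_ge0.
- rewrite mulrDl mul1r lerD// [_ * v%:R]mulrC -mulrA; exact: lnr.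
rewrite mulrCA ler_wpM2l ?addr_ge0 ?mulr_ge0// /inv_pow32 -/s ss.
rewrite !invfM -!mulrA mulVf ?gt_eqF// mulr1//.
Qed.

Lemma sum_rho_term_bound N :
  box_sum (fun m => `|rho_term R m| *
    (1 + \sum_(r < v) ln ((edge_lcm m r)%:R : R))) N <=
  (1 + 2 * v%:R) * 3 ^+ (2 ^ #|E|).
Proof.
apply: le_trans (ler_wpM2l _ (sum_inv_pow32_lcm R #|E| N)); last first.
  by rewrite addr_ge0 ?mulr_ge0.
rewrite mulr_sumr; apply: ler_sum => m _.
apply: le_trans (rho_term_bound _) _; first by move=> i; rewrite ffunE.
by rewrite /total_lcm; under eq_bigr do rewrite ffunE.
Qed.

Lemma sum_norm_rho_term N :
  box_sum (fun m => `|rho_term R m|) N <= (1 + 2 * v%:R) * 3 ^+ (2 ^ #|E|).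
Proof.
apply: le_trans (sum_rho_term_bound N); apply: ler_sum => m _.
rewrite ler_peMr// lerDl sumr_ge0// => r _.
by rewrite ln_ge0// ler1n edge_lcm_gt0// => i; rewrite ffunE.
Qed.

(** Positive and negative parts are dominated by the absolute value, so each has convergent box
    sums. *)
Lemma box_sum_rho (eps : R) : 0 < eps -> exists N0, forall N, (N0 <= N)%N ->
  `|box_sum (@rho_term R v E) N - rho R E| <= eps.
Proof.
move=> eps0.
pose hp m : R := Num.max (rho_term R m) 0.
pose hn m : R := Num.max (- rho_term R m) 0.
have hp0 m : 0 <= hp m by rewrite le_max lexx orbT.
have hn0 m : 0 <= hn m by rewrite le_max lexx orbT.
have hpK N : box_sum hp N <= (1 + 2 * v%:R) * 3 ^+ (2 ^ #|E|).
  apply: le_trans (sum_norm_rho_term N); apply: ler_sum => m _.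
  by rewrite ge_max normr_ge0 ler_norm.
have hnK N : box_sum hn N <= (1 + 2 * v%:R) * 3 ^+ (2 ^ #|E|).
  apply: le_trans (sum_norm_rho_term N); apply: ler_sum => m _.
  by rewrite ge_max normr_ge0 -normrN ler_norm.
have [sp spE spB] := esum_box_sum hp0 hpK.
have [sn snE snB] := esum_box_sum hn0 hnK.
have -> : rho R E = sp - sn.
  rewrite /rho (_ : esum _ (EFin \o _)^\+%E = sp%:E); last first.
    by rewrite -spE; apply: eq_esum => m _; rewrite funeposE /= -EFin_max.
  rewrite (_ : esum _ (EFin \o _)^\-%E = sn%:E)//.
  by rewrite -snE; apply: eq_esum => m _; rewrite funenegE /= -EFin_max.
have BE N : box_sum (@rho_term R v E) N = box_sum hp N - box_sum hn N.
  rewrite /box_sum -sumrB; apply: eq_bigr => m _; rewrite /hp /hn.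
  by case: (leP (rho_term R _) 0) => h; case: (leP (- rho_term R _) 0) => h'; lra.
have [Np NpP] := spB _ eps0; have [Nn NnP] := snB _ eps0.
(* Both box sums approach their limits from below, so the error of the difference is at most [eps],
   not twice that. *)
exists (maxn Np Nn) => N; rewrite geq_max => /andP[/NpP /andP[p1 p2] /NnP /andP[n1 n2]].
by rewrite BE ler_norml; apply/andP; split; lra.
Qed.

End Edges.

(** * Möbius expansion of the coprime sum *)

Section CoprimeSum.
Context (R : realType) (v : nat) (E : {set 'I_v * 'I_v}).
Variables (k : nat) (A : 'I_k -> {set 'I_v}).
Hypothesis hA : (\bigcup_(i < k) A i)%SET = [set: 'I_v]%SET.

(** The product over edges of the sums in [coprime_mobius] is expanded into one sum over families of
    edge divisors. *)
Lemma coprime_indicator N (a : {ffun 'I_v -> 'I_N}) :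
  \sum_(m : {ffun 'I_#|E| -> 'I_N})
     [forall r, edge_lcm (shift_ffun m) r %| (a r).+1]%N%:R *
     (\prod_(i < #|E|) mobius (shift_ffun m i))%:~R =
  [forall i : 'I_#|E|, coprime (a (enum_val i).1).+1 (a (enum_val i).2).+1]%:R :> R.
Proof.
transitivity ((\prod_(i < #|E|)
    (coprime (a (enum_val i).1).+1 (a (enum_val i).2).+1)%:R : int)%:~R : R);
    last first.
  case: forallP => [co|nco].
    by rewrite big1// => i _; rewrite co.
  have [i ni] : exists i : 'I_#|E|,
      ~~ coprime (a (enum_val i).1).+1 (a (enum_val i).2).+1.
    apply/existsP; rewrite -negb_forall; apply/negP => /forallP; exact: nco.
  by rewrite (bigD1 i)//= (negPf ni) mul0r.
under [in RHS]eq_bigr => i _ do rewrite -(@coprime_mobius N)//=.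
rewrite bigA_distr_bigA /= rmorph_sum /=; apply: eq_bigr => m _.
rewrite big_split /= intrM; congr (_ * _); last first.
  by congr (_%:~R); apply: eq_bigr => i _; rewrite ffunE.
case: edge_lcm_dvdP => [dv|ndv].
  by rewrite big1// => i _; have := dv i; rewrite ffunE => ->.
have [i ni] : exists i : 'I_#|E|, ~~ (((m i).+1 %| (a (enum_val i).1).+1)%N &&
      ((m i).+1 %| (a (enum_val i).2).+1)%N).
  apply/existsP; rewrite -negb_forall; apply/negP => /forallP h; apply: ndv => i.
  by rewrite ffunE.
by rewrite (bigD1 i)//= (negPf ni) mul0r.
Qed.

(** After exchanging the sums, multiplying and dividing by the product of the M_r splits each term
    into its [rho_term] and T(M). The identity is exact because all entries are at most x <= N. *)
Lemma coprime_sumE (x : R) N : x <= N%:R ->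
  coprime_sum E A x =
  box_sum (fun m : {ffun 'I_#|E| -> nat} =>
    rho_term R m * lattice_sum A x N (edge_lcm m)) N.
Proof.
move=> xN; rewrite /coprime_sum (@fsbig_shift _ _ _ _ N); last first.
  move=> a [a0 ax _ _] j; rewrite a0 /= -(ler_nat R).
  exact: le_trans (ax j) xN.
pose Q (a : {ffun 'I_v -> 'I_N}) :=
  [forall i, (\prod_(j in A i) (a j).+1)%N%:R <= x].
pose w (a : {ffun 'I_v -> 'I_N}) : R := (\prod_(j < v) (a j).+1%:R)^-1.
transitivity (\sum_(a | Q a) w a *
  [forall i : 'I_#|E|, coprime (a (enum_val i).1).+1 (a (enum_val i).2).+1]%:R).
  rewrite big_mkcond [RHS]big_mkcond; apply: eq_bigr => a _.
  have -> : (\prod_(j < v) (shift_ffun a j)%:R)^-1 = w a.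
    by congr (_^-1); apply: eq_bigr => j _; rewrite ffunE.
  have [ad|nad] := boolP (shift_ffun a \in admissible E A x).
    have [_ _ co pr] := set_mem ad.
    rewrite ifT; last first.
      apply/forallP => i; apply: le_trans (pr i); rewrite ler_nat.
      by apply: eq_leq; apply: eq_bigr => j _; rewrite ffunE.
    rewrite (_ : [forall i, _] = true) ?mulr1//; apply/forallP => i.
    have := co (enum_val i).1 (enum_val i).2; rewrite !ffunE; apply.
    by rewrite -surjective_pairing; exact: enum_valP.
  case: ifP => // Qa; case: forallP => [co|_]; last by rewrite mulr0.
  case/negP: nad; apply/mem_set.
  have prA i : (\prod_(j in A i) (shift_ffun a j))%N%:R <= x.
    by under eq_bigr do rewrite ffunE; exact: (forallP Qa).
  split=> // [j|j|i j ij]; first by rewrite ffunE.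
    (* The bound on a single entry follows from the product bound of an [A i] containing [j]. *)
    have [i ji] := in_some_A hA j; apply: le_trans (prA i); rewrite ler_nat.
    by rewrite (bigD1 j)//= leq_pmulr// prodn_gt0// => l; rewrite ffunE.
  by have := co (enum_rank_in ij (i, j)); rewrite enum_rankK_in// !ffunE.
under eq_bigr => a _ do rewrite -coprime_indicator mulr_sumr.
rewrite exchange_big /=; apply: eq_bigr => m _; rewrite /rho_term /lattice_sum.
have p0 : (\prod_(r < v) edge_lcm (shift_ffun m) r)%N%:R != 0 :> R.
  by rewrite pnatr_eq0 -lt0n prod_edge_lcm_gt0// => i; rewrite ffunE.
rewrite mulr_sumr big_mkcond [RHS]big_mkcond; apply: eq_bigr => a _.
rewrite /lattice_point -/(Q a) andbC; case: (Q a) => //=.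
case: ifP => _; last by rewrite mul0r mulr0.
rewrite mul1r big_split /= -natr_prod prodfV mulrC -!mulrA; congr (_ * _).
by rewrite mulrA mulVf// mul1r.
Qed.

End CoprimeSum.

(** * Combination of the expansion with the lattice point estimate *)

Theorem theorem2p2 (R : realType) (v : nat) (hv : (2 <= v)%N)
    (E : {set 'I_v * 'I_v})
    (hE : forall p, p \in E -> (p.1 < p.2)%N)
    (he : (1 <= #|E|)%N)
    (k : nat) (A : 'I_k -> {set 'I_v})
    (hA : (\bigcup_(i < k) A i)%SET = [set: 'I_v]%SET) :
  exists2 C : R, 0 < C &
    \forall x \near +oo,
      `|coprime_sum E A x - rho R E * vol_polytope R A * ln x ^+ v|
        <= C * `|ln x ^+ v.-1|.
Proof.
have v0 : (0 < v)%N := ltnW hv.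
set vol := vol_polytope R A; have vol0 : 0 <= vol := vol_polytope_ge0 R A.
pose w : R := v%:R * v.+1%:R ^+ v; have w0 : 0 <= w by rewrite mulr_ge0 ?exprn_ge0.
pose K : R := (1 + 2 * v%:R) * 3 ^+ (2 ^ #|E|).
have K0 : 0 <= K by rewrite mulr_ge0 ?exprn_ge0 ?addr_ge0 ?mulr_ge0.
(* The first summand pays for the lattice point errors, the 1 for truncating the series of [rho]. *)
exists (vol * w * K + 1); first by rewrite ltr_wpDl ?mulr_ge0.
exists (expR 1); split=> [|x ex]; first exact: num_real.
have L1 : 1 <= ln x.
  rewrite -[leLHS]expRK ler_ln ?posrE ?expR_gt0 ?ltW//.
  exact: lt_trans (expR_gt0 _) ex.
set L := ln x in L1 *; have L0 : 0 < L := lt_le_trans ltr01 L1.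
have Ln0 n : 0 <= L ^+ n by rewrite exprn_ge0// ltW.
rewrite [X in _ <= _ * X]ger0_norm// mulrDl mul1r.
(* Chosen so that, multiplied by vol L^v, it is at most L^(v-1); adding 1 to [vol], known only to be
   nonnegative, keeps the denominator positive. *)
have eps0 : 0 < ((vol + 1) * L)^-1 by rewrite invr_gt0 mulr_gt0 ?ltr_wpDl.
have [N0 N0P] := box_sum_rho hE eps0.
pose N := maxn N0 (Num.truncn x).+1.
have xN : x <= N%:R.
  by apply: (le_trans (ltW (truncnS_gt x))); rewrite ler_nat leq_maxr.
have {}N0P := N0P N (leq_maxl _ _).
rewrite (coprime_sumE E hA xN).
(* The error splits into the weighted errors of the T(M) and the truncation error of the series
   times the main term. *)
rewrite (_ : _ - _ = (box_sum (fun m : {ffun 'I_#|E| -> nat} =>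
    rho_term R m * (lattice_sum A x N (edge_lcm m) - vol * L ^+ v)) N) +
  (box_sum (@rho_term R v E) N - rho R E) * (vol * L ^+ v)); last first.
  rewrite mulrBl -[rho R E * _ * _]mulrA addrA; congr (_ - _).
  rewrite /box_sum mulr_suml -big_split /=; apply: eq_bigr => m _.
  by rewrite mulrBr subrK.
apply: le_trans (ler_normD _ _) (lerD _ _).
  apply: le_trans (ler_norm_sum _ _ _) _.
  apply: le_trans (_ : _ <= vol * w * L ^+ v.-1 * K) _; last first.
    by rewrite mulrAC.
  apply: le_trans (ler_wpM2l _ (sum_rho_term_bound R hE N)); last first.
    by rewrite !mulr_ge0.
  rewrite mulr_sumr; apply: ler_sum => m _.
  rewrite normrM mulrCA ler_wpM2l//.
  apply: le_trans (lattice_sum_approx hA _ v0 L1 xN) _.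
    by move=> r; rewrite edge_lcm_gt0// => i; rewrite ffunE.
  by rewrite -/w -/L mulrAC.
rewrite normrM [X in _ * X]ger0_norm ?mulr_ge0//.
apply: le_trans (ler_wpM2r _ N0P) _; first by rewrite mulr_ge0.
have -> : L ^+ v = L * L ^+ v.-1 by rewrite -exprS prednK.
rewrite !mulrA ler_piMl// -mulrA mulrC ler_pdivrMr ?mulr_gt0 ?ltr_wpDl//.
by rewrite mul1r ler_wpM2r ?lerDl// ltW.
Qed.
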